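(* There is an absolute constant $c>0$ such that for every $\phi\ge2$, every integer $m\ge3$ and every real $s_{\max}\ge1$ there exists a $\phi$-smooth instance $\mathcal{I}$ of scheduling on restricted related machines with $m$ machines, maximum speed $s_{\max}$ and minimum speed $s_{\min}=1$, such that \[ \mathbb{E}_{I\sim\mathcal{I}}\left[\max_{\sigma\in\mathrm{Jump}(I)}\frac{C_{\max}(I,\sigma)}{C^*_{\max}(I)}\right]\ge c\sqrt{m\cdot s_{\max}} . \]
   Context: Scheduling on restricted related machines: machines $M=\{1,\dots,m\}$ with speeds $s_{\max}=s_1\ge\dots\ge s_m=s_{\min}=1$, jobs $J=\{1,\dots,n\}$, each with a processing requirement $p_j\ge0$ and a set $\mathcal{M}_j\subseteq M$ of allowed machines; job $j$ may only be assigned to a machine $i\in\mathcal{M}_j$, where it takes time $p_j/s_i$. A (feasible) schedule $\sigma$ assigns each job $j$ to a machine in $\mathcal{M}_j$; $J_i(\sigma)$ is the set of jobs on $i$, $L_i(\sigma)=\sum_{j\in J_i(\sigma)}p_j/s_i$, $C_{\max}(I,\sigma)=\max_iL_i(\sigma)$, and $C^*_{\max}(I)$ is the minimum makespan over feasible schedules. A machine $i$ is critical if $L_i(\sigma)=C_{\max}(I,\sigma)$. $\sigma$ is jump optimal if for every critical machine $i$, every job $j\in J_i(\sigma)$ and every $i'\in\mathcal{M}_j\setminus\{i\}$: $L_{i'}(\sigma)+p_j/s_{i'}\ge L_i(\sigma)$; $\mathrm{Jump}(I)$ is the set of jump optimal schedules. A $\phi$-smooth instance $\mathcal{I}$ consists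 of a choice of $m$, the speeds, $n$, the sets $\mathcal{M}_j$, and for each job $j$ a density $f_j:[0,1]\to[0,\phi]$; the $p_j$ are drawn independently according to the $f_j$, yielding the random instance $I\sim\mathcal{I}$. (The paper states the bound as $\Omega(\sqrt{m\cdot s_{\max}})$.) *)

(* Defs.v *)
From HB Require Import structures.
From mathcomp Require Import all_boot all_order all_algebra.
From mathcomp Require Import all_classical all_reals all_analysis.
From mathcomp Require Import measurable_realfun.

Set Implicit Arguments.
Unset Strict Implicit.
Unset Printing Implicit Defensive.

Import Order.TTheory GRing.Theory Num.Theory.
Import numFieldNormedType.Exports.

Local Open Scope classical_set_scope.
Local Open Scope ring_scope.

(* Machines and jobs are numbered from 0: s_1 is the speed of machine 0 and
   s_m that of machine m-1.  The conditions on the speeds and on the allowed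
   sets are imposed in smooth_instance below. *)
Record instance (R : realType) (m n : nat) := Instance {
  speed : 'I_m -> R;
  allowed : 'I_n -> {set 'I_m};
  requirement : 'I_n -> R }.

Definition schedule (m n : nat) := {ffun 'I_n -> 'I_m}.

Definition feasible (R : realType) (m n : nat) (I : instance R m n)
    (sigma : schedule m n) : bool :=
  [forall j, sigma j \in allowed I j].

Definition load (R : realType) (m n : nat) (I : instance R m n)
    (sigma : schedule m n) (i : 'I_m) : R :=
  \sum_(j | sigma j == i) requirement I j / speed I i.

(* The default value 0 is harmless: loads are nonnegative when the
   requirements and speeds are. *)
Definition Cmax (R : realType) (m n : nat) (I : instance R m n)
    (sigma : schedule m n) : R :=
  \big[Num.max/0]_(i < m) load I sigma i.

(* The infimum is a minimum: there are finitely many schedules, and at least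
   one is feasible as soon as every set of allowed machines is nonempty. *)
Definition Copt (R : realType) (m n : nat) (I : instance R m n) : R :=
  inf [set Cmax I sigma | sigma in [set sigma | feasible I sigma]].

Definition critical (R : realType) (m n : nat) (I : instance R m n)
    (sigma : schedule m n) (i : 'I_m) : bool :=
  load I sigma i == Cmax I sigma.

Definition jump_optimal (R : realType) (m n : nat) (I : instance R m n)
    (sigma : schedule m n) : bool :=
  [forall i, critical I sigma i ==>
    [forall j, (sigma j == i) ==>
      [forall i', (i' \in allowed I j :\ i) ==>
        (load I sigma i <= load I sigma i' + requirement I j / speed I i')]]].

Definition Jump (R : realType) (m n : nat) (I : instance R m n) :
    {set schedule m n} :=
  [set sigma | feasible I sigma && jump_optimal I sigma]%SET.

(* The default value 0 is harmless: the ratios are nonnegative.  A ratio with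
   Copt I = 0 is 0 by the convention x / 0 = 0; this happens only if all
   requirements vanish, a null event below as soon as there is a job. *)
Definition worst_jump_ratio (R : realType) (m n : nat) (I : instance R m n) : R :=
  \big[Num.max/0]_(sigma in Jump I) (Cmax I sigma / Copt I).

(* A density [0,1] -> [0,phi], represented by a function on R whose values
   outside [0,1] are never used. *)
Record smooth_density (R : realType) (phi : R) := SmoothDensity {
  density :> R -> R;
  density_measurable :
    measurable_fun (`[0, 1] : set (measurableTypeR R)) density;
  density_bounded : forall x, x \in `[0, 1]%R -> 0 <= density x <= phi;
  density_integral :
    (\int[@lebesgue_measure R]_(x in `[0%R, 1%R]) (density x)%:E = 1)%E }.

Definition density_law (R : realType) (phi : R) (f : smooth_density phi)
    (A : set (measurableTypeR R)) : \bar R :=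
  (\int[@lebesgue_measure R]_(x in A `&` `[0%R, 1%R]) (f x)%:E)%E.

Section density_law_probability.
Context (R : realType) (phi : R) (f : smooth_density phi).

Let law0 : density_law f set0 = 0%E.
Proof. by rewrite /density_law set0I integral_set0. Qed.

Let law_ge0 A : (0 <= density_law f A)%E.
Proof.
apply: integral_ge0 => x [_ x01]; rewrite lee_fin.
by have /andP[] := density_bounded f x01.
Qed.

Let law_sigma_additive : semi_sigma_additive (density_law f).
Proof.
move=> F mF tF mUF; apply: cvg_toP.
  apply: ereal_nondecreasing_is_cvgn => k l kl.
  by apply: lee_sum_nneg_natr => // i _ _; exact: law_ge0.
rewrite /density_law setI_bigcupl ge0_integral_bigcup//=.
- by move=> k; apply: measurableI => //; exact: measurable_itv.
- apply/measurable_EFinP; apply: measurable_funS (density_measurable f).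
    exact: measurable_itv.
  by move=> x [k _ []].
- move=> x [k _ [_ x01]]; rewrite lee_fin.
  by have /andP[] := density_bounded f x01.
- exact: trivIset_setIr.
Qed.

HB.instance Definition _ := isMeasure.Build _ _ _ (density_law f)
  law0 law_ge0 law_sigma_additive.

Let law_setT : density_law f [set: _] = 1%E.
Proof. by rewrite /density_law setTI density_integral. Qed.

HB.instance Definition _ := @Measure_isProbability.Build _ _ R
  (density_law f) law_setT.

End density_law_probability.

Section tuple_cons.
Context (R : realType) (n : nat).

Definition tuple_cons (x : measurableTypeR R * n.-tuple (measurableTypeR R)) :
  n.+1.-tuple (measurableTypeR R) := [tuple of x.1 :: x.2].

Let measurable_tuple_cons : measurable_fun [set: _] tuple_cons.
Proof. exact: measurable_cons. Qed.

HB.instance Definition _ := isMeasurableFun.Build _ _ _ _ tuple_cons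
  measurable_tuple_cons.

End tuple_cons.

(* The joint law of independent X_0, ..., X_(n-1) with laws mu_0, ...,
   mu_(n-1): the product measure on R^n. *)
Fixpoint product_law (R : realType) (n : nat) :
    ('I_n -> probability (measurableTypeR R) R) ->
    probability (n.-tuple (measurableTypeR R)) R :=
  match n with
  | 0 => fun=> \d_([tuple] : 0.-tuple (measurableTypeR R))
  | n'.+1 => fun mu =>
      distribution (mu ord0 \x product_law (fun i => mu (lift ord0 i)))%E
        (@tuple_cons R n')
  end.

(* The product rule on boxes, which characterizes the measure. *)
Lemma product_lawE (R : realType) (n : nat)
    (mu : 'I_n -> probability (measurableTypeR R) R)
    (A : 'I_n -> set (measurableTypeR R)) :
  (forall j, measurable (A j)) ->
  product_law mu [set p | forall j, A j (tnth p j)] =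
  (\prod_(j < n) mu j (A j))%E.
Proof.
elim: n mu A => [|n IH] mu A mA /=.
  by rewrite big_ord0 diracE mem_set//= => -[].
rewrite big_ord_recl -IH//= -product_measure1E//=; last first.
  rewrite (_ : [set p | _] = \bigcap_(j in [set: 'I_n])
      ((@tnth n (measurableTypeR R) ^~ j) @^-1` A (lift ord0 j))); last first.
    by apply/seteqP; split => [p Ap j _|p Ap j]; exact: Ap.
  apply: fin_bigcap_measurable => // j _; rewrite -[_ @^-1` _]setTI.
  exact: measurable_tnth.
rewrite /distribution /pushforward; congr (_ _); apply/seteqP.
split=> -[x p] /=.
  move=> Ap; split; first exact: (Ap ord0).
  by move=> j; have := Ap (lift ord0 j); rewrite tnthS.
by move=> [Ax Ap] j; case: (unliftP ord0 j) => [k|] ->; rewrite ?tnthS.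
Qed.

(* Nonemptiness of the allowed sets says exactly that a feasible schedule
   exists. *)
Record smooth_instance (R : realType) (phi : R) (m : nat) (smax : R) :=
  SmoothInstance {
  sm_speed : 'I_m -> R;
  sm_speed_sorted : forall i i' : 'I_m, (i <= i')%N -> sm_speed i' <= sm_speed i;
  sm_speed_first : forall i : 'I_m, i = 0%N :> nat -> sm_speed i = smax;
  sm_speed_last : forall i : 'I_m, i.+1 = m -> sm_speed i = 1;
  sm_jobs : nat;
  sm_allowed : 'I_sm_jobs -> {set 'I_m};
  sm_allowed_neq0 : forall j, sm_allowed j != finset.set0;
  sm_density : 'I_sm_jobs -> smooth_density phi }.

Definition realization (R : realType) (phi : R) (m : nat) (smax : R)
    (S : smooth_instance phi m smax)
    (p : (sm_jobs S).-tuple (measurableTypeR R)) : instance R m (sm_jobs S) :=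
  Instance (@sm_speed _ _ _ _ S) (@sm_allowed _ _ _ _ S) (tnth p).

Definition requirements_law (R : realType) (phi : R) (m : nat) (smax : R)
    (S : smooth_instance phi m smax) :
    probability ((sm_jobs S).-tuple (measurableTypeR R)) R :=
  product_law (fun j => density_law (sm_density j) :
                          probability (measurableTypeR R) R).

(* The integrand is nonnegative, so the expectation makes sense in \bar R
   without any integrability assumption. *)
Definition expected_worst_jump_ratio (R : realType) (phi : R) (m : nat)
    (smax : R) (S : smooth_instance phi m smax) : \bar R :=
  'E_(requirements_law S)[fun p => worst_jump_ratio (realization p)]%E.

(* Main.v *)
Require Import Defs.
From mathcomp Require Import all_boot all_order all_algebra.
From mathcomp Require Import all_classical all_reals all_analysis.
From mathcomp Require Import measurable_realfun.
From mathcomp Require Import ring lra zify.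

(* Put L = floor(sqrt(m s_max) / 8).  One slow machine of speed 1 carries L jobs
   uniform on [1/2, 1], which may also run on k = max(1, about L / s_max) middle
   machines of speed s = L / k; the middle machines carry "mid" jobs uniform on
   [0, 1/2], which may also run on the r = m - 1 - k >= m / 6 fast machines of
   speed s_max.  In the bad schedule the slow machine is the only critical one
   and the middle machines are filled up to almost its load, so that no slow job
   wants to jump; this takes a total size of about k s L = L^2 = O(m s_max) of
   mid jobs.  The fast machines can process all 16 L^2 mid jobs in time O(1),
   and the middle machines all slow jobs, so the optimum is at most 2.  The only
   random event needed is that at least half of the mid jobs are not tiny, which
   has probability at least 1/2 by Markov's inequality.  If L < 3 the claimed
   bound is below 1 and a single job with a single allowed machine will do. *)

Set Implicit Arguments.
Unset Strict Implicit.
Unset Printing Implicit Defensive.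

Import Order.TTheory GRing.Theory Num.Theory.
Local Open Scope classical_set_scope.
Local Open Scope ring_scope.

(** * Lower bounds on expectations from bad events *)

(* Unlike in ge0_le_integral, f and g need not be measurable: worst_jump_ratio is
   never shown to be. *)
Lemma ge0_le_integral_nonmeas d (T : measurableType d) (R : realType)
    (mu : {measure set T -> \bar R}) (f g : T -> \bar R) :
  (forall x, 0 <= f x)%E -> (forall x, f x <= g x)%E ->
  (\int[mu]_x f x <= \int[mu]_x g x)%E.
Proof.
move=> f0 fg; have g0 x : (0 <= g x)%E by exact: le_trans (fg x).
rewrite !ge0_integralTE//; apply: le_ereal_sup => _ [h /= hf <-].
by exists h => //= x; exact: le_trans (fg x).
Qed.

(** [f] dominates the measurable [v * max 0 (1 - W)], where [W] is the total weight of the bad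
    events that occur and has mean at most [q]. Weight 1 excludes an event altogether; small weights
    only limit how many events occur, as in Markov's inequality. *)
Lemma integral_ge_of_bad_events d (T : measurableType d) (R : realType)
    (P : probability T R) (I : finType) (w : I -> R) (B : I -> set T)
    (f : T -> R) (v q : R) :
  (forall i, 0 <= w i) -> (forall i, measurable (B i)) -> 0 <= v ->
  (forall x, 0 <= f x) ->
  (forall x, \sum_i w i * \1_(B i) x < 1 -> v <= f x) ->
  (\sum_i (w i)%:E * P (B i) <= q%:E)%E ->
  ((v * (1 - q))%:E <= \int[P]_x (f x)%:E)%E.
Proof.
move=> w0 mB v0 f0 vf Bq.
pose W x : R := \sum_i w i * \1_(B i) x.
have mW : measurable_fun [set: T] W.
  by apply: measurable_sum => i; apply: measurable_funM.
have W0 x : 0 <= W x by apply: sumr_ge0 => i _; exact: mulr_ge0.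
pose g x : R := v * Num.max 0 (1 - W x).
have mg : measurable_fun [set: T] g.
  apply: measurable_funM => //; apply: measurable_maxr => //.
  exact: measurable_funB.
have g0 x : 0 <= g x by rewrite mulr_ge0// le_max lexx.
have gf x : g x <= f x.
  rewrite /g; have [W1|W1] := ltP (W x) 1.
    rewrite (le_trans _ (vf _ W1))// ler_piMr// ge_max ler01/=.
    by rewrite lerBlDr lerDl.
  by rewrite max_l ?mulr0// subr_le0.
have intW : (\int[P]_x (W x)%:E = \sum_i (w i)%:E * P (B i))%E.
  under eq_integral do rewrite -sumEFin.
  rewrite ge0_integral_sum//=.
  - apply: eq_bigr => i _.
    under eq_integral do rewrite EFinM.
    rewrite ge0_integralZl// ?lee_fin//; last exact/measurable_EFinP.
    by rewrite integral_indic// setIT.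
  - by move=> i; apply/measurable_EFinP; apply: measurable_funM.
  - by move=> i x _; rewrite lee_fin mulr_ge0.
have gfI : (\int[P]_x (g x)%:E <= \int[P]_x (f x)%:E)%E.
  by apply: ge0_le_integral_nonmeas => x; rewrite lee_fin.
apply: le_trans gfI.
have : (v%:E <= \int[P]_x (g x)%:E + v%:E * q%:E)%E.
  have {1}-> : v%:E = (\int[P]_x (cst v%:E) x)%E.
    by rewrite integral_cst//= probability_setT mule1.
  apply: le_trans (_ : _ <= \int[P]_x ((g x)%:E + v%:E * (W x)%:E))%E _.
    apply: ge0_le_integral => //=.
    - apply/measurable_EFinP; apply: measurable_funD => //.
      exact: measurable_funM.
    - move=> x _; rewrite -EFinM -EFinD lee_fin /g.
      rewrite -mulrDr ler_peMr//.
      have : 1 - W x <= Num.max 0 (1 - W x) by rewrite le_max lexx orbT.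
      by lra.
  rewrite ge0_integralD//=.
  - rewrite leeD2l// ge0_integralZl//; last 2 first.
    + exact/measurable_EFinP.
    + by move=> x _; rewrite lee_fin.
    by rewrite intW lee_wpmul2l.
  - by move=> x _; rewrite lee_fin.
  - exact/measurable_EFinP.
  - by move=> x _; rewrite -EFinM lee_fin mulr_ge0.
  - by apply/measurable_EFinP; apply: measurable_funM.
by rewrite mulrBr mulr1 EFinB -EFinM leeBlDr.
Qed.

Lemma product_law_marginal (R : realType) (n : nat)
    (mu : 'I_n -> probability (measurableTypeR R) R) (j : 'I_n)
    (A : set (measurableTypeR R)) : measurable A ->
  product_law mu [set p | A (tnth p j)] = mu j A.
Proof.
move=> mA; pose B i : set (measurableTypeR R) := if i == j then A else [set: _].
have mB i : measurable (B i) by rewrite /B; case: ifP.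
have -> : [set p : n.-tuple _ | A (tnth p j)] = [set p | forall i, B i (tnth p i)].
  apply/seteqP; split => [p Ap i|p /(_ j)]; rewrite /B ?eqxx//=.
  by case: eqP => // ->.
rewrite product_lawE// (bigD1 j)//= big1 ?mule1 /B ?eqxx//.
by move=> i /negbTE ->; rewrite probability_setT.
Qed.

(** * Uniform laws on intervals of length 1/2 *)

Section half_density.
Context (R : realType) (phi a : R) (phi2 : 2 <= phi) (a0 : 0 <= a)
  (a1 : a <= 1 / 2).

Let supp : set R := `[a, a + 1 / 2]%classic.

(** The height 2 of this uniform density is where [2 <= phi] enters; [a <= 1 / 2] keeps the support
    inside the unit interval. *)
Let half (x : R) : R := 2 * \1_supp x.

Let mhalf (D : set (measurableTypeR R)) : measurable_fun D half.
Proof.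
apply: measurable_funM => //; apply: measurable_indic.
exact: measurable_itv.
Qed.

Let half_int (D : set R) : measurable D ->
  (\int[@lebesgue_measure R]_(t in D) (half t)%:E =
   2%:E * @lebesgue_measure R (D `&` supp))%E.
Proof.
move=> mD; under eq_integral do rewrite EFinM.
rewrite ge0_integralZl//=.
- have msupp : measurable (supp : set (measurableTypeR R)).
    exact: measurable_itv.
  by rewrite (integral_indic (@lebesgue_measure R) mD msupp) setIC.
- apply/measurable_EFinP/measurable_indic; exact: measurable_itv.
Qed.

Let half_bounded x : x \in `[0, 1]%R -> 0 <= half x <= phi.
Proof.
move=> _; rewrite /half mulr_ge0//= indicE.
case: (_ \in _) => /=; first by rewrite mulr1.
by rewrite mulr0 (le_trans _ phi2).
Qed.

Let half_mass : (\int[@lebesgue_measure R]_(x in `[0%R, 1%R]) (half x)%:E = 1)%E.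
Proof.
rewrite half_int; last exact: measurable_itv.
rewrite (_ : _ `&` _ = supp); last first.
  apply: classical_sets.setIidr => x; rewrite /supp /= !in_itv /= => /andP[ax xa].
  by move: a0 a1 => a0' a1'; apply/andP; split; lra.
rewrite /supp lebesgue_measure_itv/= lte_fin ifT; last lra.
by rewrite -EFinB -EFinM; congr EFin; field.
Qed.

Definition half_density : smooth_density phi :=
  SmoothDensity (mhalf (D := _)) half_bounded half_mass.

Lemma half_density_itvC (x y : R) : a <= x -> x <= y -> y <= a + 1 / 2 ->
  density_law half_density (~` `[x, y])%classic = (1 - 2 * (y - x))%:E.
Proof.
move=> ax xy ya; rewrite [LHS]probability_setC; last exact: measurable_itv.
rewrite /= /density_law half_int; last first.
  by apply: measurableI; exact: measurable_itv.
rewrite (_ : _ `&` _ = `[x, y]%classic); last first.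
  apply/seteqP; split=> t; rewrite /supp /= !in_itv /=.
    by case=> -[].
  move: a0 a1 => a0' a1' /andP[xt ty]; do 2?split => //; apply/andP; split; lra.
rewrite lebesgue_measure_itv/= lte_fin; case: ltP => [_|yx].
  by rewrite -EFinB.
by rewrite (_ : y - x = 0) ?mulr0 ?mule0 ?sube0 ?subr0//; lra.
Qed.
End half_density.

(** * Makespan, optimum and worst ratio *)

Section makespan_bounds.
Context (R : realType) (m n : nat) (I : instance R m n).

Lemma load_le_Cmax (sigma : schedule m n) i : load I sigma i <= Cmax I sigma.
Proof. exact: le_bigmax. Qed.

Lemma Cmax_ge0 (sigma : schedule m n) : 0 <= Cmax I sigma.
Proof. exact: bigmax_ge_id. Qed.

Lemma Cmax_le (sigma : schedule m n) b :
  0 <= b -> (forall i, load I sigma i <= b) -> Cmax I sigma <= b.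
Proof. by move=> b0 lb; apply: bigmax_le => // i _; exact: lb. Qed.

Lemma Copt_le_Cmax (sigma : schedule m n) :
  feasible I sigma -> Copt I <= Cmax I sigma.
Proof.
move=> fs; apply: ge_inf; last by exists sigma.
by exists 0 => _ [tau _ <-]; exact: Cmax_ge0.
Qed.

(** The feasible [sigma] rules out an infimum over the empty set, which is 0 by default. *)
Lemma Copt_ge (sigma : schedule m n) b : feasible I sigma ->
  (forall tau, feasible I tau -> b <= Cmax I tau) -> b <= Copt I.
Proof.
move=> fs lb; apply: lb_le_inf; first by exists (Cmax I sigma), sigma.
by move=> _ [tau ft <-]; exact: lb.
Qed.

Lemma worst_jump_ratio_ge (sigma : schedule m n) : sigma \in Jump I ->
  Cmax I sigma / Copt I <= worst_jump_ratio I.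
Proof. by move=> sJ; rewrite /worst_jump_ratio; exact: le_bigmax_cond. Qed.

Lemma worst_jump_ratio_ge0 : 0 <= worst_jump_ratio I.
Proof. exact: bigmax_ge_id. Qed.

End makespan_bounds.

(** * Counting jobs dealt in round robin *)

Lemma card_ord_itv n a b : (#|[set i : 'I_n | (a <= i < a + b)%N]%SET| <= b)%N.
Proof.
rewrite cardE -(size_map val) -[leqRHS](size_iota a).
apply: uniq_leq_size; first by rewrite map_inj_uniq ?enum_uniq//; exact: val_inj.
by move=> _ /mapP[i + ->]; rewrite mem_enum inE mem_iota.
Qed.

Lemma card_residue_class n a b d c : (0 < d)%N ->
  (#|[set j : 'I_n | (a <= j < a + b) && ((j - a) %% d == c)]%SET| <=
   (b %/ d).+1)%N.
Proof.
move=> d0; rewrite cardE -(size_map (fun j : 'I_n => (j - a) %/ d)%N).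
rewrite -[leqRHS](size_iota 0); apply: uniq_leq_size.
  rewrite map_inj_in_uniq ?enum_uniq// => i j.
  rewrite !mem_enum !inE => /andP[/andP[ai _] /eqP ic] /andP[/andP[aj _] /eqP jc].
  move=> ij; apply: val_inj => /=.
  have : (i - a = j - a)%N by rewrite (divn_eq (i - a) d) ij ic -jc -divn_eq.
  by lia.
move=> _ /mapP[j + ->]; rewrite mem_enum inE mem_iota /= => /andP[/andP[aj jb] _].
by rewrite add0n ltnS leq_div2r//; lia.
Qed.

(** Bounds the load of one of [d] machines to which [b] consecutive jobs are dealt in turn, [u]
    bounding each processing time. *)
Lemma sum_residue_class_le (R : realType) n a b d c (Q : pred 'I_n)
    (x : 'I_n -> R) (u : R) : (0 < d)%N -> 0 <= u ->
  (forall j, Q j -> [/\ (a <= j < a + b)%N, ((j - a) %% d)%N = c & x j <= u]) ->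
  \sum_(j | Q j) x j <= u * (b%:R / d%:R + 1).
Proof.
move=> d0 u0 Qx; apply: (@le_trans _ _ (\sum_(j | Q j) u)).
  by apply: ler_sum => j /Qx[].
rewrite sumr_const -[u *+ _]mulr_natr ler_wpM2l//.
apply: (@le_trans _ _ (b %/ d).+1%:R).
  rewrite ler_nat; apply: leq_trans (@card_residue_class n a b d c d0).
  apply/subset_leq_card/fintype.subsetP => j Qj; rewrite inE.
  by have [-> -> _] := Qx _ Qj; rewrite eqxx.
rewrite -natr1 lerD2r ler_pdivlMr ?ltr0n// -natrM ler_nat.
exact: leq_trunc_div.
Qed.

Lemma sum_ord_lt (R : nmodType) (n0 N : nat) (F : 'I_(n0 + N) -> R) :
  \sum_(j : 'I_(n0 + N) | (j < n0)%N) F j = \sum_(i < n0) F (lshift N i).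
Proof.
rewrite big_split_ord/= [X in _ + X]big_pred0 ?addr0.
  by apply: eq_bigl => i; rewrite ltn_ord.
by move=> i; rewrite ltnNge leq_addr.
Qed.

Lemma sum_ord_ge (R : nmodType) (n0 N : nat) (F : 'I_(n0 + N) -> R) :
  \sum_(j : 'I_(n0 + N) | (n0 <= j)%N) F j = \sum_(i < N) F (rshift n0 i).
Proof.
rewrite big_split_ord/= big_pred0 ?add0r.
  by apply: eq_bigl => i; rewrite leq_addr.
by move=> i; rewrite leqNgt ltn_ord.
Qed.

(** * The hard instance for fixed requirements *)

Section hard_instance.
Context (R : realType) (n0 N k r : nat) (smax s : R).
Local Notation m := (r + k).+1.
Local Notation n := (n0 + N)%N.

(* The machines are numbered fast (i < r), middle (r <= i < r + k), slow (r + k);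
   the jobs are numbered slow (j < n0), mid (n0 <= j). *)
Definition hard_speed (i : 'I_m) : R :=
  if (i < r)%N then smax else if (i < r + k)%N then s else 1.

Definition hard_allowed (j : 'I_n) : {set 'I_m} :=
  if (j < n0)%N then [set i : 'I_m | (r <= i)%N]%SET
  else [set i : 'I_m | (i < r + k)%N]%SET.

Context (p : 'I_n -> R).
Let I := Instance hard_speed hard_allowed p.
Let L0 : R := \sum_(j : 'I_n | (j < n0)%N) p j.

Hypotheses (s1 : 1 <= s) (ssmax : s <= smax) (r0 : (0 < r)%N) (k0 : (0 < k)%N).
Hypothesis n03 : (3 <= n0)%N.
Hypothesis p_slow : forall j : 'I_n, (j < n0)%N -> 1 / 2 <= p j <= 1.
Hypothesis p_mid : forall j : 'I_n, (n0 <= j)%N -> 0 <= p j <= 1 / 2.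

Let smax1 : 1 <= smax. Proof. exact: le_trans ssmax. Qed.
Let s_gt0 : 0 < s. Proof. exact: lt_le_trans s1. Qed.
Let smax_gt0 : 0 < smax. Proof. exact: lt_le_trans smax1. Qed.

Let p_ge0 j : 0 <= p j.
Proof.
have [/p_slow/andP[+ _]|/p_mid/andP[]//] := ltnP j n0.
by apply: le_trans; rewrite divr_ge0.
Qed.

(** Serves both the near-optimal and the bad schedule, hence only an inclusion is assumed: the jobs
    on [i] are among the mid jobs dealt to [i], some of which may be elsewhere. *)
Lemma hard_load_fast (sigma : schedule m n) (i : 'I_m) : (i < r)%N ->
  (forall j, sigma j = i -> (n0 <= j)%N /\ ((j - n0) %% r = i)%N) ->
  load I sigma i <= N%:R / (2 * r%:R * smax) + 1 / 2.
Proof.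
move=> ir ci; rewrite /load /= /hard_speed ir.
apply: le_trans (_ : _ <= 1 / 2 / smax * (N%:R / r%:R + 1)) _.
  apply: (@sum_residue_class_le _ _ n0 N r i) => //.
    by rewrite divr_ge0// ?divr_ge0 ?ltW.
  move=> j /eqP/ci[nj jr]; split=> //; first by rewrite nj /=.
  by rewrite ler_pM2r ?invr_gt0//; have /andP[] := p_mid nj.
have smv : smax^-1 <= 1 by rewrite invf_le1.
rewrite mulrDr mulr1 lerD//; last by rewrite ler_piMr// divr_ge0.
rewrite le_eqVlt; apply/orP; left; apply/eqP; field.
by rewrite pnatr_eq0 -lt0n r0 gt_eqF.
Qed.

(** Witness that the optimum is at most 2. The [j - 0] fits [sum_residue_class_le] with [a = 0]. *)
Let tau : schedule m n := [ffun j : 'I_n =>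
  if (j < n0)%N then inord (r + (j - 0) %% k) else inord ((j - n0) %% r)].

Let tau_slow (j : 'I_n) : (j < n0)%N -> tau j = (r + (j - 0) %% k)%N :> nat.
Proof.
move=> jn; rewrite ffunE jn inordK// ltnS leq_add2l.
by rewrite ltnW// ltn_mod.
Qed.

Let tau_mid (j : 'I_n) : (n0 <= j)%N -> tau j = ((j - n0) %% r)%N :> nat.
Proof.
move=> nj; rewrite ffunE ltnNge nj /= inordK//.
have := ltn_pmod (j - n0) r0; lia.
Qed.

Let tau_feasible : feasible I tau.
Proof.
apply/forallP => j; rewrite /= /hard_allowed; case: ltnP => nj; rewrite inE.
  by rewrite tau_slow// leq_addr.
by rewrite tau_mid// (leq_trans (ltn_pmod _ r0))// leq_addr.
Qed.

Let hard_speed_gt0 i : 0 < hard_speed i.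
Proof. by rewrite /hard_speed; case: ifP => _ //; case: ifP. Qed.

Let hard_speed_le i : hard_speed i <= smax.
Proof. by rewrite /hard_speed; case: ifP => _ //; case: ifP. Qed.

(** Job 0 is slow, hence of size at least 1/2, and no machine is faster than [smax]. Positivity
    matters because a ratio with [Copt I = 0] counts as 0. *)
Lemma hard_Copt_gt0 : 0 < Copt I.
Proof.
apply: (@lt_le_trans _ _ (1 / 2 / smax)); first by rewrite divr_gt0.
apply: (Copt_ge tau_feasible) => sigma _.
have n_gt0 : (0 < n)%N by lia.
pose j0 : 'I_n := Ordinal n_gt0.
apply: le_trans (load_le_Cmax I sigma (sigma j0)).
rewrite /load (bigD1 j0)//= ler_wpDr//.
  by apply: sumr_ge0 => j _; rewrite divr_ge0// ltW.
have /p_slow/andP[pj _] : (j0 < n0)%N by rewrite /=; lia.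
apply: ler_pM; rewrite ?divr_ge0 ?invr_ge0 ?(ltW smax_gt0)//.
by rewrite lef_pV2 ?posrE//; exact: hard_speed_le.
Qed.

(** Under [tau] a fast machine has load at most [3 / 4 + 1 / 2], a middle one at most
    [(n0 / k + 1) / s = 1 + 1 / s], and the slow one is empty. *)
Lemma hard_Copt_le2 : s = n0%:R / k%:R ->
  N%:R / (2 * r%:R * smax) <= 3 / 4 :> R -> Copt I <= 2.
Proof.
move=> sE Nr; apply: le_trans (Copt_le_Cmax tau_feasible) _.
apply: Cmax_le => // i; have [ir|ri] := ltnP i r.
  apply: le_trans (_ : _ <= 3 / 4 + 1 / 2) _; last by lra.
  apply: le_trans (hard_load_fast ir _) _; last by rewrite lerD2r.
  move=> j tji; have [nj|nj] := ltnP j n0; last by rewrite -tji tau_mid.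
  by have := tau_slow nj; rewrite tji; lia.
have [irk|rki] := ltnP i (r + k).
  rewrite /load /= /hard_speed ltnNge ri /= irk.
  apply: le_trans (_ : _ <= 1 / s * (n0%:R / k%:R + 1)) _.
    apply: (@sum_residue_class_le _ _ 0 n0 k (i - r)) => //.
      by rewrite divr_ge0// ltW.
    move=> j /eqP tji; have [nj|nj] := ltnP j n0; last first.
      have := tau_mid nj; have := ltn_pmod (j - n0) r0; rewrite tji; lia.
    have := tau_slow nj; rewrite tji => ->; split; rewrite ?addKn//.
    by rewrite ler_pM2r ?invr_gt0//; have /andP[] := p_slow nj.
  rewrite -sE mulrDr mulr1 mul1r mulVf ?gt_eqF//.
  by have : s^-1 <= 1 by [rewrite invf_le1]; lra.
rewrite /load big_pred0// => j; apply/eqP => tji.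
have [nj|nj] := ltnP j n0.
  have := tau_slow nj; have := ltn_pmod (j - 0) k0; rewrite tji; lia.
have := tau_mid nj; have := ltn_pmod (j - n0) r0; rewrite tji; lia.
Qed.

Let slow : 'I_m := ord_max.

Let load_slow (sigma : schedule m n) :
  (forall j : 'I_n, (sigma j == slow) = (j < n0)%N) -> load I sigma slow = L0.
Proof.
move=> sj; rewrite /load /L0; apply: eq_big => // j _ /=.
by rewrite /hard_speed /= ltnNge leq_addr /= ltnn divr1.
Qed.

(** [5 / 4 = 3 / 4 + 1 / 2] bounds the loads of the fast machines, which must stay below the slow
    one; three slow jobs already reach [3 / 2]. *)
Let L0_gt : 5 / 4 < L0.
Proof.
apply: (@lt_le_trans _ _ (3 * (1 / 2))); first by lra.
apply: (@le_trans _ _ (n0%:R * (1 / 2))).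
  by rewrite ler_wpM2r ?divr_ge0// ler_nat.
rewrite /L0 sum_ord_lt mulr_natl -[in leLHS](card_ord n0) -sumr_const.
by apply: ler_sum => i _; have /andP[] := @p_slow (lshift N i) (ltn_ord i).
Qed.

Let L0_le : L0 <= n0%:R.
Proof.
rewrite /L0 sum_ord_lt -[in leRHS](card_ord n0) -sumr_const.
by apply: ler_sum => i _; have /andP[] := @p_slow (lshift N i) (ltn_ord i).
Qed.

(* A schedule with as many mid jobs as possible on the middle machines, subject
   to keeping these below the slow machine: mid jobs have size at most 1/2, so
   a middle machine that cannot take another one is already so full that no
   slow job, of size at least 1/2, gains by jumping to it. *)
Lemma hard_schedule : s = n0%:R / k%:R ->
  n0%:R ^+ 2 <= \sum_(j : 'I_n | (n0 <= j)%N) p j ->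
  exists sigma : schedule m n,
    [/\ forall j : 'I_n, (j < n0)%N -> sigma j = slow,
        forall j : 'I_n, (n0 <= j)%N ->
          sigma j = ((j - n0) %% r)%N :> nat \/ (r <= sigma j < r + k)%N,
        forall i : 'I_m, (r <= i < r + k)%N -> load I sigma i < L0 &
        forall i : 'I_m, (r <= i < r + k)%N -> L0 - 1 / 2 / s <= load I sigma i].
Proof.
move=> sE pn0.
pose good (sigma : schedule m n) :=
  [&& [forall j : 'I_n, (j < n0)%N ==> (sigma j == slow)],
      [forall j : 'I_n, (n0 <= j)%N ==>
        ((sigma j == ((j - n0) %% r)%N :> nat) || (r <= sigma j < r + k)%N)] &
      [forall i : 'I_m, (r <= i < r + k)%N ==> (load I sigma i < L0)]].
have goodP sigma : good sigma ->
  [/\ forall j : 'I_n, (j < n0)%N -> sigma j = slow,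
      forall j : 'I_n, (n0 <= j)%N ->
        sigma j = ((j - n0) %% r)%N :> nat \/ (r <= sigma j < r + k)%N &
      forall i : 'I_m, (r <= i < r + k)%N -> load I sigma i < L0].
  move=> /and3P[/forallP h1 /forallP h2 /forallP h3]; split.
  - by move=> j nj; have /implyP/(_ nj)/eqP := h1 j.
  - by move=> j nj; have /implyP/(_ nj)/orP[/eqP|] := h2 j; [left|right].
  - by move=> i ri; have /implyP/(_ ri) := h3 i.
pose sigma0 : schedule m n :=
  [ffun j : 'I_n => if (j < n0)%N then slow else inord ((j - n0) %% r)].
have sigma0_mid (j : 'I_n) : (n0 <= j)%N -> sigma0 j = ((j - n0) %% r)%N :> nat.
  by move=> nj; rewrite -tau_mid// !ffunE ltnNge nj.
have good0 : good sigma0.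
  apply/and3P; split; apply/forallP => x; apply/implyP => hx.
  - by rewrite ffunE hx.
  - by rewrite sigma0_mid// eqxx.
  - rewrite /load big_pred0; first by apply: lt_trans L0_gt; lra.
    move=> j; apply/eqP => jx; have [nj|nj] := ltnP j n0.
      by move: hx; rewrite -jx ffunE nj /= ltnn andbF.
    by move: hx; rewrite -jx sigma0_mid// leqNgt ltn_mod r0.
(* A good schedule has no mid job on the slow machine, so [cnt] counts the mid jobs on middle
   machines. *)
pose cnt (sigma : schedule m n) :=
  #|[set j : 'I_n | (n0 <= j)%N && (r <= sigma j)%N]%SET|.
case: (arg_maxnP cnt good0) => sigma gs smx.
have [h1 h2 h3] := goodP _ gs.
exists sigma; split=> // i hi; rewrite leNgt; apply/negP => li.
have speed_mid (i' : 'I_m) : (r <= i' < r + k)%N -> hard_speed i' = s.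
  by move=> /andP[ri ik]; rewrite /hard_speed ltnNge ri /= ik.
(* A mid job on a fast machine could move to the underfull [i]: the result stays good and has larger
   [cnt], against maximality. *)
have [/existsP[j /andP[nj jr]]|] :=
    boolP [exists j : 'I_n, (n0 <= j)%N && (sigma j < r)%N].
  pose sigma' : schedule m n := [ffun j' => if j' == j then i else sigma j'].
  have load' (i' : 'I_m) : (r <= i' < r + k)%N ->
      load I sigma' i' = load I sigma i' + (i' == i)%:R * (p j / s).
    move=> hi'; rewrite /load; have [->|i'i] := eqVneq i' i.
      rewrite (bigD1 j)/=; last by rewrite ffunE eqxx.
      rewrite speed_mid// mul1r addrC; congr (_ + _); apply: eq_bigl => j'.
      rewrite ffunE; have [->|_] /= := eqVneq j' j; last by rewrite andbT.
      by rewrite andbF; apply/esym/eqP => ji; move: jr; rewrite ji ltnNge; case/andP: hi => ->.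
    rewrite mul0r addr0; apply: eq_bigl => j'; rewrite ffunE.
    have [->|_] // := eqVneq j' j; rewrite eq_sym (negbTE i'i).
    by apply/esym/eqP => ji; move: jr; rewrite ji ltnNge; case/andP: hi' => ->.
  have gs' : good sigma'.
    apply/and3P; split; apply/forallP => x; apply/implyP => hx.
    - rewrite ffunE; have [xj|_] := eqVneq x j; last by rewrite h1.
      by move: nj; rewrite -xj leqNgt hx.
    - rewrite ffunE; have [_|_] := eqVneq x j; first by rewrite hi orbT.
      by have [->|->] := h2 _ hx; rewrite ?eqxx ?orbT.
    - rewrite load'//; have [->|_] := eqVneq x i; last by rewrite mul0r addr0 h3.
      rewrite mul1r; have /andP[_ pj] := p_mid nj.
      have : p j / s <= 1 / 2 / s by rewrite ler_pM2r ?invr_gt0.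
      by move: li; lra.
  have := smx _ gs'; rewrite /cnt.
  have -> : [set j' : 'I_n | (n0 <= j')%N && (r <= sigma' j')%N]%SET =
      (j |: [set j' : 'I_n | (n0 <= j')%N && (r <= sigma j')%N])%SET.
    apply/setP => j'; rewrite !inE ffunE; have [->|//] := eqVneq j' j.
    by rewrite nj; case/andP: hi => ->.
  by rewrite cardsU1 inE nj (leqNgt r) jr /= add1n ltnn.
(* Otherwise the middle machines carry all mid jobs, of total size less than
   [k * s * L0 = n0 * L0 <= n0 ^ 2], against [pn0]. The inequality is strict because of [i]. *)
rewrite negb_exists => /forallP none.
have mids (j : 'I_n) : (n0 <= j)%N = (r <= sigma j < r + k)%N.
  have [nj|nj] := ltnP j n0; first by rewrite h1//= ltnn andbF.
  have [sj|->//] := h2 _ nj.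
  by have := none j; rewrite nj /= sj ltn_mod r0.
have : \sum_(j : 'I_n | (n0 <= j)%N) p j < n0%:R ^+ 2; last by rewrite ltNge pn0.
under eq_bigl do rewrite mids.
rewrite (partition_big sigma (fun i : 'I_m => r <= i < r + k)%N)//=.
apply: (@lt_le_trans _ _ (\sum_(i : 'I_m | (r <= i < r + k)%N) (L0 * s))).
  apply: ltr_sum; first by apply/hasP; exists i; rewrite ?mem_index_enum.
  move=> i' hi'; rewrite -ltr_pdivrMr// mulr_suml.
  rewrite (eq_bigl (fun j => sigma j == i')); last first.
    by move=> j /=; case: eqP => [->|]; rewrite ?hi' ?andbF.
  by apply: le_lt_trans (h3 _ hi'); rewrite /load /= speed_mid.
rewrite sumr_const -[_ *+ _]mulr_natr.
apply: (@le_trans _ _ (L0 * s * k%:R)).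
  rewrite ler_wpM2l ?mulr_ge0 ?(ltW s_gt0)//; first by move: L0_gt; lra.
  by rewrite ler_nat -cardsE card_ord_itv.
by rewrite sE mulrA mulfVK ?pnatr_eq0 -?lt0n// expr2 ler_wpM2r.
Qed.

(** Only the slow machine attains [L0], so only slow jobs need checking. They have size at least 1/2
    and can only jump to middle machines, whose loads are at least [L0 - 1 / 2 / s]. *)
Lemma hard_jump : s = n0%:R / k%:R ->
  N%:R / (2 * r%:R * smax) <= 3 / 4 :> R ->
  n0%:R ^+ 2 <= \sum_(j : 'I_n | (n0 <= j)%N) p j ->
  exists2 sigma, sigma \in Jump I & Cmax I sigma = L0.
Proof.
move=> sE Nr pn0; have [sigma [h1 h2 h3 h4]] := hard_schedule sE pn0.
have not_slow (j : 'I_n) : (n0 <= j)%N -> (sigma j < r + k)%N.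
  move=> nj; have [->|/andP[]//] := h2 _ nj.
  by rewrite (leq_trans (ltn_pmod _ r0))// leq_addr.
have fast (i : 'I_m) : (i < r)%N -> load I sigma i < L0.
  move=> ir; apply: le_lt_trans L0_gt.
  apply: le_trans (hard_load_fast ir _) _; last by move: Nr; lra.
  move=> j sj; have [nj|nj] := ltnP j n0.
    by move: ir; rewrite -sj h1//= ltnNge leq_addr.
  split=> //; have [sje|] := h2 _ nj; first by rewrite -sj.
  by rewrite sj leqNgt ir.
have slowL : load I sigma slow = L0.
  apply: load_slow => j; have [nj|nj] := ltnP j n0; first by rewrite h1 ?eqxx.
  by apply/eqP => sj; have := not_slow _ nj; rewrite sj /= ltnn.
have other i : i != slow -> load I sigma i < L0.
  move=> islow; have [ir|ri] := ltnP i r; first exact: fast.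
  apply: h3; rewrite ri /= ltn_neqAle -ltnS ltn_ord andbT.
  by apply: contra islow => /eqP ie; apply/eqP/val_inj.
have CL : Cmax I sigma = L0.
  apply/le_anti/andP; split; last by rewrite -slowL load_le_Cmax.
  apply: Cmax_le => [|i]; first by move: L0_gt; lra.
  by have [->|/other/ltW//] := eqVneq i slow; rewrite slowL.
exists sigma => //; rewrite inE; apply/andP; split.
  apply/forallP => j; rewrite /= /hard_allowed; case: ltnP => nj; rewrite inE.
    by rewrite h1//= leq_addr.
  exact: not_slow.
apply/forallP => i; apply/implyP; rewrite /critical CL => /eqP iL.
have {iL} -> : i = slow.
  by apply/eqP/negPn/negP => /other; rewrite iL ltxx.
apply/forallP => j; apply/implyP => /eqP sj.
have nj : (j < n0)%N.
  by rewrite ltnNge; apply/negP => /not_slow; rewrite sj /= ltnn.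
apply/forallP => i'; apply/implyP; rewrite /= /hard_allowed nj !inE => /andP[i's ri].
have hi : (r <= i' < r + k)%N.
  rewrite ri ltn_neqAle -ltnS ltn_ord andbT.
  by apply: contra i's => /eqP ie; apply/eqP/val_inj.
rewrite slowL; have := h4 _ hi; rewrite /hard_speed ltnNge ri /=.
have -> : (i' < r + k)%N by case/andP: hi.
have : 1 / 2 / s <= p j / s.
  by rewrite ler_pM2r ?invr_gt0//; have /andP[] := p_slow nj.
by move=> a b; lra.
Qed.

Lemma hard_worst_jump_ratio : s = n0%:R / k%:R ->
  N%:R / (2 * r%:R * smax) <= 3 / 4 :> R ->
  n0%:R ^+ 2 <= \sum_(j : 'I_n | (n0 <= j)%N) p j ->
  n0%:R / 4 <= worst_jump_ratio I.
Proof.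
move=> sE Nr pn0; have [sigma sJ CL] := hard_jump sE Nr pn0.
apply: le_trans (worst_jump_ratio_ge sJ); rewrite CL.
have C0 := hard_Copt_gt0; rewrite ler_pdivlMr//.
apply: (@le_trans _ _ (n0%:R / 2)).
  have -> : n0%:R / 2 = n0%:R / 4 * 2 :> R by field.
  by rewrite ler_wpM2l ?divr_ge0// hard_Copt_le2.
rewrite /L0 sum_ord_lt -div1r mulr_natl -[in leLHS](card_ord n0) -sumr_const.
by apply: ler_sum => i _; have /andP[] := @p_slow (lshift N i) (ltn_ord i).
Qed.

End hard_instance.

(** * Random instances *)

(** Each bad event concerns one requirement, so its probability is read off from the density of that
    job. *)
Lemma expected_ratio_ge_of_bad_coordinates (R : realType) (phi smax : R) (m : nat)
    (S : smooth_instance phi m smax) (I : finType) (w : I -> R)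
    (c : I -> 'I_(sm_jobs S)) (B : I -> set (measurableTypeR R)) (v q : R) :
  (forall i, 0 <= w i) -> (forall i, measurable (B i)) -> 0 <= v ->
  (forall p, \sum_i w i * \1_(B i) (tnth p (c i)) < 1 ->
     v <= worst_jump_ratio (realization p)) ->
  (\sum_i (w i)%:E * density_law (sm_density (c i)) (B i) <= q%:E)%E ->
  ((v * (1 - q))%:E <= expected_worst_jump_ratio S)%E.
Proof.
move=> w0 mB v0 vr Bq; rewrite /expected_worst_jump_ratio unlock.
apply: (@integral_ge_of_bad_events _ _ _ _ I w
  (fun i => [set p | B i (tnth p (c i))])) => //.
- by move=> i; rewrite -[X in measurable X]setTI; exact: measurable_tnth.
- by move=> p; exact: worst_jump_ratio_ge0.
- apply: le_trans Bq; rewrite le_eqVlt; apply/orP; left; apply/eqP.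
  by apply: eq_bigr => i _; rewrite /requirements_law product_law_marginal.
Qed.

(** With a single feasible schedule the ratio is 1 as soon as the only requirement is positive. *)
Lemma trivial_smooth_instance (R : realType) (phi smax : R) (m : nat) :
  2 <= phi -> (3 <= m)%N -> 1 <= smax ->
  exists S : smooth_instance phi m smax,
    (1%:E <= expected_worst_jump_ratio S)%E.
Proof.
move=> phi2 m3 smax1; have m0 : (0 < m)%N by lia.
pose i0 : 'I_m := Ordinal m0.
pose sp (i : 'I_m) : R := if i == 0%N :> nat then smax else 1.
have sp_gt0 i : 0 < sp i by rewrite /sp; case: ifP => // _; lra.
have sp_sorted (i i' : 'I_m) : (i <= i')%N -> sp i' <= sp i.
  rewrite /sp; case: eqP => [->|_]; first by rewrite leqn0 => /eqP ->; rewrite eqxx.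
  by case: eqP.
have sp_first (i : 'I_m) : i = 0%N :> nat -> sp i = smax by rewrite /sp => ->.
have sp_last (i : 'I_m) : i.+1 = m -> sp i = 1.
  by rewrite /sp; case: eqP => // ->; lia.
pose al (_ : 'I_1) : {set 'I_m} := [set i0]%SET.
have al0 j : al j != finset.set0 by apply/set0Pn; exists i0; rewrite inE.
have h0 : 0 <= 1 / 2 :> R by rewrite divr_ge0.
pose dens (_ : 'I_1) := half_density phi2 h0 (lexx (1 / 2)).
pose S := SmoothInstance sp_sorted sp_first sp_last al0 dens.
exists S; rewrite (_ : 1 = 1 * (1 - 0)); last by rewrite mul1r subr0.
apply: (@expected_ratio_ge_of_bad_coordinates _ _ _ _ S 'I_1 (fun=> 1) (fun=> ord0)
  (fun=> ~` `[1 / 2, 1])) => //.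
- by move=> _; apply: measurableC; exact: measurable_itv.
- move=> p; rewrite big_ord1 mul1r indicE; case: (boolP (_ \in _)) => //=.
    by rewrite ltxx.
  rewrite notin_setE /= => /contrapT; rewrite in_itv/= => /andP[p12 _] _.
  set I := realization p.
  pose sigma : schedule m 1 := [ffun=> i0].
  have fs : feasible I sigma by apply/forallP => j; rewrite ffunE inE.
  have fE tau : feasible I tau -> tau = sigma.
    move=> /forallP ft; apply/ffunP => j; rewrite ffunE.
    by have := ft j; rewrite inE => /eqP.
  have sJ : sigma \in Jump I.
    rewrite inE fs /=; apply/forallP => i; apply/implyP => _.
    apply/forallP => j; apply/implyP => /eqP <-.
    apply/forallP => i'; apply/implyP; rewrite ffunE !inE => /andP[/negP i'0 /eqP].
    by move=> ?; case: i'0; apply/eqP.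
  apply: le_trans (worst_jump_ratio_ge sJ).
  have Cgt : 0 < Cmax I sigma.
    apply: lt_le_trans (load_le_Cmax I sigma i0).
    rewrite /load big_mkcond big_ord1 ffunE eqxx.
    apply: divr_gt0; last exact: sp_gt0.
    by rewrite /=; lra.
  have -> : Copt I = Cmax I sigma.
    apply/le_anti/andP; split; first exact: Copt_le_Cmax.
    by apply: (Copt_ge fs) => tau /fE ->.
  by rewrite divff// gt_eqF.
- rewrite big_ord1 mul1e half_density_itvC ?lee_fin//; lra.
Qed.

(** As [8 * n0 ^ 2 = N / 2], the last hypothesis is the bound [3 / 4] on the round-robin load of the
    fast machines. *)
Lemma hard_smooth_instance (R : realType) (phi smax s : R) (n0 k r : nat) :
  2 <= phi -> 1 <= s -> s <= smax -> (0 < r)%N -> (0 < k)%N -> (3 <= n0)%N ->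
  s = n0%:R / k%:R -> 8 * n0%:R ^+ 2 <= 3 / 4 * (r%:R * smax) ->
  exists S : smooth_instance phi (r + k).+1 smax,
    ((n0%:R / 8)%:E <= expected_worst_jump_ratio S)%E.
Proof.
(* If half of these [N] mid jobs have size at least 1/8, their total size is at least
   [N / 16 = n0 ^ 2]. *)
move=> phi2 s1 ss r0 k0 n03 sE n0r; pose N := (16 * n0 ^ 2)%N.
have N0 : (0 < N)%N by rewrite /N; lia.
have NR : N%:R = 16 * n0%:R ^+ 2 :> R by rewrite /N natrM natrX.
pose sp := @hard_speed R k r smax s.
have sp_sorted (i i' : 'I_(r + k).+1) : (i <= i')%N -> sp i' <= sp i.
  move=> ii'; rewrite /sp /hard_speed; case: ltnP => [i'r|_].
    by rewrite (leq_ltn_trans ii').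
  case: ltnP => [i'rk|_].
    by case: ltnP => // _; rewrite (leq_ltn_trans ii').
  by case: ltnP => [|_]; [rewrite (le_trans s1)|case: ltnP].
have sp_first (i : 'I_(r + k).+1) : i = 0%N :> nat -> sp i = smax.
  by move=> i0; rewrite /sp /hard_speed i0 r0.
have sp_last (i : 'I_(r + k).+1) : i.+1 = (r + k).+1 -> sp i = 1.
  by move=> [irk]; rewrite /sp /hard_speed irk ltnn ltnNge leq_addr.
pose al := @hard_allowed n0 N k r.
have al0 j : al j != finset.set0.
  rewrite /al /hard_allowed; apply/set0Pn; case: ifP => _.
    by exists ord_max; rewrite inE /= leq_addr.
  by exists ord0; rewrite inE /= addn_gt0 r0.
pose a (j : 'I_(n0 + N)) : R := if (j < n0)%N then 1 / 2 else 0.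
have a0 j : 0 <= a j by rewrite /a; case: ifP => // _; rewrite divr_ge0.
have a1 j : a j <= 1 / 2 by rewrite /a; case: ifP => // _; rewrite divr_ge0.
pose dens j := half_density phi2 (a0 j) (a1 j).
pose S := SmoothInstance sp_sorted sp_first sp_last al0 dens.
exists S; rewrite (_ : n0%:R / 8 = n0%:R / 4 * (1 - 1 / 2)); last by field.
(* Bad events, for each job: leaving the support of the law, with weight 1;
   for the mid jobs also being less than 1/8, with weight 2 / N. *)
pose w (i : 'I_(n0 + N) + 'I_(n0 + N)) : R :=
  match i with inl _ => 1 | inr j => if (j < n0)%N then 0 else 2 / N%:R end.
pose c (i : 'I_(n0 + N) + 'I_(n0 + N)) : 'I_(sm_jobs S) :=
  match i with inl j => j | inr j => j end.
pose B (i : 'I_(n0 + N) + 'I_(n0 + N)) : set (measurableTypeR R) :=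
  match i with
  | inl j => ~` `[a j, a j + 1 / 2] | inr j => ~` `[1 / 8, 1 / 2] end.
apply: (@expected_ratio_ge_of_bad_coordinates _ _ _ _ S _ w c B).
- by case=> j /=; [|case: ifP => // _; rewrite divr_ge0].
- by case=> j /=; apply: measurableC; exact: measurable_itv.
- by rewrite divr_ge0.
- move=> p; rewrite big_sumType /= => W1.
  have w0 (j : 'I_(n0 + N)) : 0 <= w (inr j).
    by rewrite /=; case: ifP => // _; rewrite divr_ge0.
  (* A single requirement outside its support would already contribute weight 1. *)
  have psupp j : a j <= tnth p j <= a j + 1 / 2.
    apply/negPn/negP => pj; move: W1; rewrite (bigD1 j)//= mul1r indicE.
    rewrite mem_set/=; last by rewrite in_itv /=; apply/negP.
    apply/negP; rewrite -leNgt -addrA lerDl addr_ge0//; apply: sumr_ge0 => i _.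
      by rewrite mul1r.
    by rewrite mulr_ge0// (w0 i).
  have Wmid : \sum_(j : 'I_(n0 + N)) w (inr j) *
      (\1_(~` `[1 / 8, 1 / 2]) (tnth p j) : R) < 1.
    apply: le_lt_trans _ W1; rewrite lerDr; apply: sumr_ge0 => i _.
    by rewrite mul1r.
  apply: (@hard_worst_jump_ratio _ n0 N k r smax s) => //.
  + by move=> j nj; have := psupp j; rewrite /a nj; lra.
  + by move=> j nj; have := psupp j; rewrite /a ltnNge nj /=; lra.
  + rewrite NR ler_pdivrMr; last by rewrite !mulr_gt0 ?ltr0n//; lra.
    by move: n0r; lra.
  + have : \sum_(j : 'I_(n0 + N) | (n0 <= j)%N)
        (\1_(~` `[1 / 8, 1 / 2]) (tnth p j) : R) < N%:R / 2.
      rewrite -[ltRHS]mul1r -ltr_pdivrMr ?divr_gt0 ?ltr0n//; apply: le_lt_trans _ Wmid.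
      rewrite mulr_suml [leRHS](bigID (fun j : 'I_(n0 + N) => (n0 <= j)%N)) /=.
      rewrite [X in _ <= _ + X]big1 ?addr0.
        apply: ler_sum => j nj; rewrite ltnNge nj /= mulrC invf_div.
        by rewrite lexx.
      by move=> j nj; rewrite ltnNge nj mul0r.
    (* A mid job has size at least 1/8 off its bad event and at least 0 on it. *)
    have : \sum_(j : 'I_(n0 + N) | (n0 <= j)%N)
        (8^-1 - 8^-1 * (\1_(~` `[1 / 8, 1 / 2]) (tnth p j) : R)) <=
        \sum_(j : 'I_(n0 + N) | (n0 <= j)%N) tnth p j.
      apply: ler_sum => j nj; have := psupp j; rewrite /a ltnNge nj /= => pj.
      rewrite indicE; case: (boolP (_ \in _)) => [_|] /=.
        by rewrite mulr1 subrr; case/andP: pj.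
      rewrite notin_setE /= => /contrapT; rewrite in_itv /= => /andP[p8 _].
      by rewrite mulr0 subr0 -div1r.
    rewrite big_split /= sumrN -mulr_sumr [X in X - _]sum_ord_ge sumr_const.
    rewrite card_ord -[_ *+ N]mulr_natr => h1 h2.
    have : N%:R = 16 * n0%:R ^+ 2 :> R by []; move: h1 h2.
    set X := \sum_(j | _) _; set Y := \sum_(j | _) _; lra.
- rewrite big_sumType /= big1 ?add0e; last first.
    move=> j _; rewrite mul1e half_density_itvC//; last by rewrite lerDl divr_ge0.
    by congr EFin; field.
  (* A uniform size on [[0, 1 / 2]] misses [[1 / 8, 1 / 2]] with probability 1/4, which is
     multiplied by the weight [2 / N]. *)
  apply: (@le_trans _ _ (\sum_(j < n0 + N) (if (j < n0)%N then 0 else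
      1 / (2 * N%:R))%:E)%E).
    apply: lee_sum => j _; rewrite /a; case: ifP => nj; first by rewrite mul0e.
    have aj0 : a j = 0 by rewrite /a nj.
    rewrite half_density_itvC; [|by rewrite aj0; lra|by lra|by rewrite aj0; lra].
    rewrite -EFinM lee_fin le_eqVlt; apply/orP; left; apply/eqP; field.
    by rewrite pnatr_eq0 -lt0n.
  rewrite sumEFin lee_fin (bigID (fun j : 'I_(n0 + N) => (n0 <= j)%N)) /=.
  rewrite [X in _ + X]big1 ?addr0; last first.
    by move=> j; rewrite -ltnNge => ->.
  rewrite sum_ord_ge (eq_bigr (fun=> 1 / (2 * N%:R))); last first.
    by move=> j _ /=; rewrite ltnNge leq_addr.
  rewrite sumr_const card_ord -[_ *+ N]mulr_natr.
  rewrite le_eqVlt; apply/orP; left; apply/eqP; field.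
  by rewrite pnatr_eq0 -lt0n.
Qed.

(** * Choice of the parameters *)

Lemma machine_split (m k : nat) : (3 <= m)%N -> (8 * k <= m + 8)%N ->
  exists r, [/\ m = (r + k).+1, (0 < r)%N & (m <= 6 * r)%N].
Proof. by move=> m3 k8; exists (m - 1 - k)%N; split; lia. Qed.

Theorem theorem20 (R : realType) :
  exists2 c : R, 0 < c &
    forall (phi : R) (m : nat) (smax : R),
      2 <= phi -> (3 <= m)%N -> 1 <= smax ->
      exists S : smooth_instance phi m smax,
        ((c * Num.sqrt (m%:R * smax))%:E <= expected_worst_jump_ratio S)%E.
Proof.
(* For [n0 < 3] one has [x < 24], so the bound is below 1; for [n0 >= 3],
   [x < 8 * (n0 + 1) <= 32 / 3 * n0], so [x / 100 < n0 / 8]. *)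
exists (1 / 100) => [|phi m smax phi2 m3 smax1]; first by rewrite divr_gt0.
set x := Num.sqrt _.
have m1 : 1 <= m%:R :> R by rewrite ler1n; lia.
have X1 : 1 <= m%:R * smax by rewrite -[leLHS]mulr1 ler_pM.
have x2 : x ^+ 2 = m%:R * smax by rewrite sqr_sqrtr// (le_trans ler01).
have x0 : 0 <= x by rewrite sqrtr_ge0.
have x1 : 1 <= x by rewrite -sqrtr1 ler_sqrt// (le_trans ler01).
pose n0 := Num.truncn (x / 8).
have /andP[n0x xn0] : n0%:R <= x / 8 < n0.+1%:R.
  by apply: truncn_itv; rewrite divr_ge0.
have [n03|n03] := leqP 3 n0; last first.
  have [S hS] := trivial_smooth_instance phi2 m3 smax1.
  exists S; apply: le_trans hS; rewrite lee_fin.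
  have : n0.+1%:R <= 3 :> R by rewrite ler_nat.
  by lra.
have smax0 : 0 < smax by rewrite (lt_le_trans ltr01).
(* With [s = n0 / k], [k <= n0] gives [s >= 1]. Either [k = n0] and [s = 1], or [k > n0 / smax], so
   [s <= smax] in both cases. *)
pose k := minn n0 (Num.truncn (n0%:R / smax)).+1.
have /andP[kl ku] : (Num.truncn (n0%:R / smax))%:R <= n0%:R / smax <
    (Num.truncn (n0%:R / smax)).+1%:R.
  by apply: truncn_itv; rewrite divr_ge0// ltW.
have k0 : (0 < k)%N by rewrite leq_min (leq_trans _ n03).
have kn0 : (k <= n0)%N by rewrite geq_minl.
(* [k <= n0 / smax + 1], and [n0 <= x / 8 <= m * smax / 8] because [x <= x ^ 2]. *)
have k8 : (8 * k <= m + 8)%N.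
  apply: (@leq_trans (8 * (Num.truncn (n0%:R / smax)).+1)).
    by rewrite leq_mul2l geq_minr orbT.
  rewrite mulnS addnC leq_add2r -(ler_nat R) natrM.
  suff : n0%:R / smax <= m%:R / 8 by move: kl; lra.
  rewrite ler_pdivrMr//; suff : x <= m%:R * smax by move: n0x; lra.
  by rewrite -x2 expr2 ler_peMl.
have [r [mE r0 mr]] := machine_split m3 k8.
have s1 : 1 <= n0%:R / k%:R :> R.
  by rewrite ler_pdivlMr ?ltr0n// mul1r ler_nat.
have ss : n0%:R / k%:R <= smax.
  rewrite ler_pdivrMr ?ltr0n// mulrC /k /minn; case: ifP => _.
    by rewrite ler_peMr.
  by rewrite -ler_pdivrMr// ltW.
(* [n0 ^ 2 <= m * smax / 64 <= 6 * r * smax / 64], which is where the constant [3 / 4] comes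
   from. *)
have n0r : 8 * n0%:R ^+ 2 <= 3 / 4 * (r%:R * smax).
  have h1 : n0%:R ^+ 2 <= (x / 8) ^+ 2 by apply: lerXn2r; rewrite ?nnegrE ?divr_ge0.
  have h2 : m%:R * smax <= 6 * (r%:R * smax).
    by rewrite mulrA ler_wpM2r// ?(ltW smax0)// -natrM ler_nat.
  by move: h1; rewrite expr_div_n x2; lra.
have := hard_smooth_instance phi2 s1 ss r0 k0 n03 erefl n0r.
rewrite -mE => -[S hS].
exists S; apply: le_trans hS; rewrite lee_fin.
have : 3 <= n0%:R :> R by rewrite ler_nat.
by move: xn0; rewrite -[n0.+1%:R]natr1; lra.
Qed.
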